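(* Let $(\eta,\boldsymbol{u}_1,\boldsymbol{u}_2,P_1,P_2)$ be a (classical) solution of the steady internal wave problem (as defined in the context) such that $\|\boldsymbol{u}_1\|_{C^0}<\infty$ and $\|\boldsymbol{u}_2\|_{C^0}<\infty$ (i.e. $\boldsymbol{u}_i$ is bounded on $\Omega_i$ for $i=1,2$), and such that the vorticities $\boldsymbol{\omega}_1$ and $\boldsymbol{\omega}_2$ are nonzero constant vectors in $\mathbb{R}^3$. Then the third components of $\boldsymbol{\omega}_1$ and of $\boldsymbol{\omega}_2$ both vanish.
   Context: Steady internal wave problem. Fix constants $h_1,h_2>0$ (depths), $\rho_1,\rho_2>0$ (densities) and $g>0$ (gravitational acceleration), and Cartesian coordinates $(x,y,z)\in\mathbb{R}^3$ with $z$ vertical. The interface is the graph of a function $\eta\in C^1(\mathbb{R}^2)$, $\eta=\eta(x,y)$, with $-h_1<\inf\eta$ and $\sup\eta<h_2$. The lower and upper fluid layers are $$\Omega_1=\{(x,y,z)\in\mathbb{R}^3: -h_1<z<\eta(x,y)\},\qquad \Omega_2=\{(x,y,z)\in\mathbb{R}^3:\eta(x,y)<z<h_2\}.$$ A (classical) solution consists of such an $\eta$ together with velocity fields $\boldsymbol{u}_i=(u_i,v_i,w_i)\in C^1(\overline{\Omega_i};\mathbb{R}^3)$ and pressures $P_i\in C^1(\overline{\Omega_i})$, $i=1,2$, such that: (1) $\rho_i(\boldsymbol{u}_i\cdot\nabla)\boldsymbol{u}_i=-\nabla P_i+\rho_i(0,0,-g)$ in $\Omega_i$, for $i=1,2$;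 (2) $\nabla\cdot\boldsymbol{u}_i=0$ in $\Omega_i$, for $i=1,2$; (3) $u_i\eta_x+v_i\eta_y=w_i$ on $z=\eta(x,y)$, for $i=1,2$; (4) $P_1=P_2$ on $z=\eta(x,y)$; (5) $w_1=0$ on $z=-h_1$ and $w_2=0$ on $z=h_2$. The functions $\boldsymbol{u}_i$, $P_i$ are not assumed bounded, periodic, or to have any prescribed behavior at infinity unless stated. The vorticity in $\Omega_i$ is $\boldsymbol{\omega}_i=\nabla\times\boldsymbol{u}_i=(\partial_y w_i-\partial_z v_i,\ \partial_z u_i-\partial_x w_i,\ \partial_x v_i-\partial_y u_i)$. *)

(* Defs.v *)
From Stdlib Require Export Reals.
From Coquelicot Require Export Coquelicot.
Open Scope R_scope.

Notation R2 := (R * R)%type.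
Notation R3 := (R * R * R)%type.

Definition cx (a : R3) : R := fst (fst a).
Definition cy (a : R3) : R := snd (fst a).
Definition cz (a : R3) : R := snd a.

Definition closure {U : UniformSpace} (D : U -> Prop) (p : U) : Prop :=
  forall eps : posreal, exists q : U, ball p eps q /\ D q.

Definition eta_x (eta : R2 -> R) (q : R2) : R :=
  Derive (fun t => eta (t, snd q)) (fst q).
Definition eta_y (eta : R2 -> R) (q : R2) : R :=
  Derive (fun t => eta (fst q, t)) (snd q).

Definition C1_plane (eta : R2 -> R) : Prop :=
  forall q : R2,
    ex_derive (fun t => eta (t, snd q)) (fst q) /\
    ex_derive (fun t => eta (fst q, t)) (snd q) /\
    continuous (eta_x eta) q /\
    continuous (eta_y eta) q.

Definition dx (f : R3 -> R) (p : R3) : R := Derive (fun t => f (t, cy p, cz p)) (cx p).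
Definition dy (f : R3 -> R) (p : R3) : R := Derive (fun t => f (cx p, t, cz p)) (cy p).
Definition dz (f : R3 -> R) (p : R3) : R := Derive (fun t => f (cx p, cy p, t)) (cz p).

Definition has_partials (f : R3 -> R) (p : R3) : Prop :=
  ex_derive (fun t => f (t, cy p, cz p)) (cx p) /\
  ex_derive (fun t => f (cx p, t, cz p)) (cy p) /\
  ex_derive (fun t => f (cx p, cy p, t)) (cz p).

Definition extends_to_closure (D : R3 -> Prop) (f : R3 -> R) : Prop :=
  exists F : R3 -> R,
    continuous_on (closure D) F /\ (forall p, D p -> F p = f p).

(* f is of class C^1 on the closure of the open set D: f is continuous on the
   closure, and its partial derivatives exist in D and extend continuously to
   the closure. A total function stands for its restriction to the closure;
   its values elsewhere play no role. *)
Definition C1_closure (D : R3 -> Prop) (f : R3 -> R) : Prop :=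
  continuous_on (closure D) f /\
  (forall p, D p -> has_partials f p) /\
  extends_to_closure D (dx f) /\
  extends_to_closure D (dy f) /\
  extends_to_closure D (dz f).

Definition C1_closure_vec (D : R3 -> Prop) (u : R3 -> R3) : Prop :=
  C1_closure D (fun p => cx (u p)) /\
  C1_closure D (fun p => cy (u p)) /\
  C1_closure D (fun p => cz (u p)).

Definition grad (f : R3 -> R) (p : R3) : R3 := (dx f p, dy f p, dz f p).

Definition div (u : R3 -> R3) (p : R3) : R :=
  dx (fun q => cx (u q)) p + dy (fun q => cy (u q)) p + dz (fun q => cz (u q)) p.

Definition curl (u : R3 -> R3) (p : R3) : R3 :=
  (dy (fun q => cz (u q)) p - dz (fun q => cy (u q)) p,
   dz (fun q => cx (u q)) p - dx (fun q => cz (u q)) p,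
   dx (fun q => cy (u q)) p - dy (fun q => cx (u q)) p).

(* (u . nabla) f *)
Definition advect (u : R3 -> R3) (f : R3 -> R) (p : R3) : R :=
  cx (u p) * dx f p + cy (u p) * dy f p + cz (u p) * dz f p.

(* (u . nabla) u *)
Definition convective (u : R3 -> R3) (p : R3) : R3 :=
  (advect u (fun q => cx (u q)) p,
   advect u (fun q => cy (u q)) p,
   advect u (fun q => cz (u q)) p).

Definition Omega1 (h1 : R) (eta : R2 -> R) (p : R3) : Prop :=
  - h1 < cz p < eta (cx p, cy p).
Definition Omega2 (h2 : R) (eta : R2 -> R) (p : R3) : Prop :=
  eta (cx p, cy p) < cz p < h2.

Definition range (eta : R2 -> R) (t : R) : Prop := exists q, eta q = t.

Definition euler (rho g : R) (D : R3 -> Prop) (u : R3 -> R3) (P : R3 -> R) : Prop :=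
  forall p, D p ->
    scal rho (convective u p) = plus (opp (grad P p)) (scal rho ((0, 0, - g) : R3)).

Definition kinematic (eta : R2 -> R) (u : R3 -> R3) : Prop :=
  forall x y,
    let U := u (x, y, eta (x, y)) in
    cx U * eta_x eta (x, y) + cy U * eta_y eta (x, y) = cz U.

Record internal_wave (h1 h2 rho1 rho2 g : R) (eta : R2 -> R)
    (u1 u2 : R3 -> R3) (P1 P2 : R3 -> R) : Prop := {
  iw_eta_C1 : C1_plane eta;
  iw_eta_inf : Rbar_lt (Finite (- h1)) (Glb_Rbar (range eta));
  iw_eta_sup : Rbar_lt (Lub_Rbar (range eta)) (Finite h2);
  iw_u1_C1 : C1_closure_vec (Omega1 h1 eta) u1;
  iw_u2_C1 : C1_closure_vec (Omega2 h2 eta) u2;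
  iw_P1_C1 : C1_closure (Omega1 h1 eta) P1;
  iw_P2_C1 : C1_closure (Omega2 h2 eta) P2;
  iw_euler1 : euler rho1 g (Omega1 h1 eta) u1 P1;
  iw_euler2 : euler rho2 g (Omega2 h2 eta) u2 P2;
  iw_div1 : forall p, Omega1 h1 eta p -> div u1 p = 0;
  iw_div2 : forall p, Omega2 h2 eta p -> div u2 p = 0;
  iw_kinematic1 : kinematic eta u1;
  iw_kinematic2 : kinematic eta u2;
  iw_dynamic : forall x y, P1 (x, y, eta (x, y)) = P2 (x, y, eta (x, y));
  iw_bottom : forall x y, cz (u1 (x, y, - h1)) = 0;
  iw_top : forall x y, cz (u2 (x, y, h2)) = 0
}.

(* The norm of the product normed module R * R * R is the Euclidean norm. *)
Definition bounded_on (D : R3 -> Prop) (u : R3 -> R3) : Prop :=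
  exists M : R, forall p, D p -> norm (u p) <= M.

(* Main.v *)
Require Import Defs.
From Stdlib Require Import Reals Lra.
From Coquelicot Require Import Coquelicot.
Open Scope R_scope.

(** Each layer contains a full horizontal plane, on which the velocity is
    bounded and the vertical vorticity is constant.
    By Stokes' theorem, the circulation of the horizontal velocity around a
    square of side [L] in that plane equals the flux [omega_z * L ^ 2] of the
    vorticity, whereas boundedness by [M] makes it at most [4 * M * L].
    Letting [L] grow forces [omega_z = 0].

    [bounded_constant_curl_plane] is this planar statement and
    [constant_vertical_vorticity_zero] transfers it to a horizontal plane in
    three-dimensional space. The required planes exist because the
    interface stays at a positive distance from the bottom and from the lid. *)

(** Green's theorem on the square is replaced by the mean value theorem for
    [A y], the integral of [a x y] over [x] in [[0, L]]: differentiating under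
    the integral sign, [A' y] is [b L y - b 0 y - c * L], which is within
    [2 * M] of [- c * L], while [A] itself is bounded by [M * L]. *)
Lemma bounded_constant_curl_plane (a b : R -> R -> R) (c M : R)
  (hax : forall x y, ex_derive (fun t => a t y) x)
  (hay : forall x y, ex_derive (fun t => a x t) y)
  (hbx : forall x y, ex_derive (fun t => b t y) x)
  (hcont : forall x y,
     continuity_2d_pt (fun v u => Derive (fun t => a u t) v) y x)
  (hcurl : forall x y,
     Derive (fun t => b t y) x - Derive (fun t => a x t) y = c)
  (hMa : forall x y, Rabs (a x y) <= M)
  (hMb : forall x y, Rabs (b x y) <= M) :
  c = 0.
Proof.
destruct (Req_dec c 0) as [|hc]; [assumption|exfalso].
assert (hM : 0 <= M) by (generalize (hMa 0 0) (Rabs_pos (a 0 0)); lra).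
assert (hc' : 0 < Rabs c) by now apply Rabs_pos_lt.
(* Any side longer than [4 * M / |c|] contradicts the circulation bound. *)
set (L := (4 * M + 1) / Rabs c).
assert (hL : 0 < L) by (apply Rdiv_lt_0_compat; lra).
assert (hcL : Rabs c * L = 4 * M + 1) by (unfold L; field; lra).
assert (hint : forall y, ex_RInt (fun x => a x y) 0 L).
{ intros y; apply (ex_RInt_continuous (V := R_CompleteNormedModule)); intros x _.
  apply (ex_derive_continuous (fun t => a t y)), hax. }
assert (hayx : forall x y, continuous (fun x => Derive (fun t => a x t) y) x).
{ intros x y; apply continuity_pt_filterlim.
  intros eps heps; destruct (hcont x y (mkposreal eps heps)) as [d hd].
  exists d; split; [apply cond_pos|].
  intros x' [_ hx']; apply hd; [rewrite Rminus_diag, Rabs_R0; apply cond_pos|].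
  exact hx'. }
set (A := fun y => RInt (fun x => a x y) 0 L).
assert (hder : forall y, is_derive A y (b L y - b 0 y - c * L)).
{ intros y.
  assert (h : is_derive A y (RInt (fun x => Derive (fun t => a x t) y) 0 L)).
  { apply (is_derive_RInt_param (fun y x => a x y)).
    - apply filter_forall; intros; apply hay.
    - intros; apply hcont.
    - apply filter_forall; intros; apply hint. }
  replace (b L y - b 0 y - c * L)
    with (RInt (fun x => Derive (fun t => a x t) y) 0 L); [exact h|].
  assert (hext : forall x,
    Derive (fun t => a x t) y = Derive (fun t => b t y) x - c).
  { intros x; generalize (hcurl x y); lra. }
  apply is_RInt_unique.
  replace (b L y - b 0 y - c * L)
    with (minus (b L y - c * L) (b 0 y - c * 0))
    by (unfold minus, plus, opp; simpl; ring).
  apply (is_RInt_derive (fun x => b x y - c * x)); intros x _.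
  - rewrite hext. auto_derive; [apply hbx | ring].
  - apply hayx. }
assert (hA : forall y, Rabs (A y) <= L * M).
{ intros y; unfold A.
  replace (L * M) with ((L - 0) * M) by ring.
  apply abs_RInt_le_const; [lra|apply hint|intros; apply hMa]. }
destruct (MVT_gen A 0 L (fun y => b L y - b 0 y - c * L)) as [y [_ hy]].
- intros; apply hder.
- intros y _; apply continuity_pt_filterlim, (ex_derive_continuous A).
  eexists; apply hder.
- assert (h : c * L * L = (b L y - b 0 y) * L - (A L - A 0)) by (rewrite hy; ring).
  apply (f_equal Rabs) in h; rewrite !Rabs_mult, (Rabs_pos_eq L) in h; [|lra].
  assert (h1 : Rabs (b L y - b 0 y) * L <= 2 * M * L).
  { apply Rmult_le_compat_r; [lra|].
    generalize (Rabs_triang (b L y) (- b 0 y)) (hMb L y) (hMb 0 y).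
    unfold Rminus; rewrite Rabs_Ropp; lra. }
  generalize (Rabs_triang ((b L y - b 0 y) * L) (- (A L - A 0)))
    (Rabs_triang (A L) (- A 0)) (hA L) (hA 0).
  unfold Rminus in *; rewrite !Rabs_Ropp, Rabs_mult, (Rabs_pos_eq L); [|lra].
  rewrite hcL in h. intros.
  assert ((4 * M + 1) * L <= 4 * M * L) by lra.
  nra.
Qed.

Lemma norm_R3_cx (p : R3) : Rabs (cx p) <= norm p.
Proof.
destruct p as [[x y] z].
eapply Rle_trans; [|apply (norm_prod (x, y) z)].
eapply Rle_trans; [apply Rmax_l|].
eapply Rle_trans; [apply (norm_prod x y)|apply Rmax_l].
Qed.

Lemma norm_R3_cy (p : R3) : Rabs (cy p) <= norm p.
Proof.
destruct p as [[x y] z].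
eapply Rle_trans; [|apply (norm_prod (x, y) z)].
eapply Rle_trans; [|apply Rmax_l].
eapply Rle_trans; [apply Rmax_r|apply (norm_prod x y)].
Qed.

(** The plane never leaves [D], where the function agrees with its continuous
    extension, so restricting the neighbourhoods to the closure of [D] excludes
    no nearby point of the plane. *)
Lemma extends_to_closure_plane (D : R3 -> Prop) (f : R3 -> R) (z : R)
  (hD : forall x y, D (x, y, z)) (hf : extends_to_closure D f) (x y : R) :
  continuity_2d_pt (fun v u => f (u, v, z)) y x.
Proof.
destruct hf as [F [hF hFf]]; intros eps.
assert (hcl : forall p, D p -> closure D p).
{ intros p hp e; exists p; split; [apply ball_center|exact hp]. }
destruct (hF _ (hcl _ (hD x y)) (ball (F (x, y, z)) eps)) as [d hd].
{ apply locally_ball. }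
exists d; intros v u hv hu.
rewrite <- !hFf; [|apply hD|apply hD].
apply (hd (u, v, z)); [|apply hcl, hD].
split; [split; [exact hu|exact hv]|apply ball_center].
Qed.

Lemma constant_vertical_vorticity_zero (D : R3 -> Prop) (u : R3 -> R3)
  (omega : R3) (z : R)
  (hD : forall x y, D (x, y, z))
  (hu : C1_closure_vec D u)
  (hb : bounded_on D u)
  (hcurl : forall p, D p -> curl u p = omega) :
  cz omega = 0.
Proof.
destruct hu as [[_ [hx [_ [hxy _]]]] [[_ [hy _]] _]].
destruct hb as [M hM].
apply (bounded_constant_curl_plane
  (fun x y => cx (u (x, y, z))) (fun x y => cy (u (x, y, z))) _ M).
- intros x y; apply (hx (x, y, z)), hD.
- intros x y; apply (hx (x, y, z)), hD.
- intros x y; apply (hy (x, y, z)), hD.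
- intros x y; apply (extends_to_closure_plane D _ z hD hxy).
- intros x y; rewrite <- (hcurl (x, y, z)); [reflexivity|apply hD].
- intros x y; eapply Rle_trans; [apply norm_R3_cx|apply hM, hD].
- intros x y; eapply Rle_trans; [apply norm_R3_cy|apply hM, hD].
Qed.

Lemma Glb_Rbar_gap (E : R -> Prop) (m : R) (hne : exists t, E t)
  (h : Rbar_lt m (Glb_Rbar E)) :
  exists z, m < z /\ forall t, E t -> z < t.
Proof.
destruct (Glb_Rbar_correct E) as [hlb _]; destruct hne as [t0 ht0].
destruct (Glb_Rbar E) as [l| |]; simpl in h.
- exists ((m + l) / 2); split; [lra|].
  intros t ht; generalize (hlb t ht); simpl; lra.
- destruct (hlb t0 ht0).
- destruct h.
Qed.

Lemma Lub_Rbar_gap (E : R -> Prop) (m : R) (hne : exists t, E t)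
  (h : Rbar_lt (Lub_Rbar E) m) :
  exists z, z < m /\ forall t, E t -> t < z.
Proof.
destruct (Lub_Rbar_correct E) as [hub _]; destruct hne as [t0 ht0].
destruct (Lub_Rbar E) as [l| |]; simpl in h.
- exists ((l + m) / 2); split; [lra|].
  intros t ht; generalize (hub t ht); simpl; lra.
- destruct h.
- destruct (hub t0 ht0).
Qed.

Theorem theorem1p1
  (h1 h2 rho1 rho2 g : R)
  (hh1 : 0 < h1) (hh2 : 0 < h2) (hrho1 : 0 < rho1) (hrho2 : 0 < rho2) (hg : 0 < g)
  (eta : R2 -> R) (u1 u2 : R3 -> R3) (P1 P2 : R3 -> R)
  (hsol : internal_wave h1 h2 rho1 rho2 g eta u1 u2 P1 P2)
  (hb1 : bounded_on (Omega1 h1 eta) u1)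
  (hb2 : bounded_on (Omega2 h2 eta) u2)
  (omega1 omega2 : R3)
  (hnz1 : omega1 <> (0, 0, 0)) (hnz2 : omega2 <> (0, 0, 0))
  (hcurl1 : forall p : R3, Omega1 h1 eta p -> curl u1 p = omega1)
  (hcurl2 : forall p : R3, Omega2 h2 eta p -> curl u2 p = omega2) :
  cz omega1 = 0 /\ cz omega2 = 0.
Proof.
assert (hrange : forall q, range eta (eta q)) by (intros q; now exists q).
assert (hne : exists t, range eta t) by (exists (eta (0, 0)); apply hrange).
destruct (Glb_Rbar_gap _ _ hne (iw_eta_inf _ _ _ _ _ _ _ _ _ _ hsol))
  as [z1 [hz1 hz1']].
destruct (Lub_Rbar_gap _ _ hne (iw_eta_sup _ _ _ _ _ _ _ _ _ _ hsol))
  as [z2 [hz2 hz2']].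
split.
- apply (constant_vertical_vorticity_zero (Omega1 h1 eta) u1 omega1 z1);
    [|apply (iw_u1_C1 _ _ _ _ _ _ _ _ _ _ hsol)|exact hb1|exact hcurl1].
  intros x y; split; [exact hz1|apply hz1', hrange].
- apply (constant_vertical_vorticity_zero (Omega2 h2 eta) u2 omega2 z2);
    [|apply (iw_u2_C1 _ _ _ _ _ _ _ _ _ _ hsol)|exact hb2|exact hcurl2].
  intros x y; split; [apply hz2', hrange|exact hz2].
Qed.
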